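(* Let $\Lambda\subset H^*$ and $\Lambda_H\subset\mathbb{M}_H$ be closed and convex with $\Lambda_H\subset\Lambda$, let $f\in H^*$ and $w\in H$. Let $(u,\lambda)\in H\times\Lambda$ satisfy $$a(u,v)+b(\lambda,v)=\langle f,v\rangle,\qquad b(\mu-\lambda,u)\le\langle\mu-\lambda,w\rangle\qquad\text{for all }(v,\mu)\in H\times\Lambda,$$ and let $(u_h,\lambda_H)\in\mathbb{V}_h\times\Lambda_H$ satisfy $$a(u_h,v_h)+b(\lambda_H,v_h)=\langle f,v_h\rangle,\qquad b(\mu_H-\lambda_H,u_h)\le\langle\mu_H-\lambda_H,w\rangle\qquad\text{for all }(v_h,\mu_H)\in\mathbb{V}_h\times\Lambda_H.$$ Assume the discrete inf-sup condition: there is $\hat\beta>0$, independent of the mesh sizes, with $$\hat\beta\|\mu_H\|_{H^*}\le\sup_{0\ne v_h\in\mathbb{V}_h}\frac{b(\mu_H,v_h)}{\|v_h\|_H}\qquad\text{for all }\mu_H\in\mathbb{M}_H.$$ Then, for all $(v_h,\mu_H)\in\mathbb{V}_h\times\Lambda_H$, $$\|u-u_h\|_H^2\lesssim\|u-v_h\|_H^2+\|\lambda-\mu_H\|_{H^*}^2+\|\lambda-\lambda_H\|_{H^*}^2,$$ $$\|\lambda-\lambda_H\|_{H^*}\lesssim\|u-u_h\|_H+\|\lambda-\mu_H\|_{H^*}.$$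
   Context: Let $0<s<1$ and let $\Omega\subset\mathbb{R}^n$ be a bounded Lipschitz domain with polygonal boundary. $H^s(\Omega)$ has norm $\|v\|_{L^2(\Omega)}+|v|_{H^s(\Omega)}$, $|v|^2_{H^s(\Omega)}=\iint_{\Omega\times\Omega}\frac{(v(x)-v(y))^2}{|x-y|^{n+2s}}\,dy\,dx$. $H$ is either $H^s_0(\Omega)$ (closure in $H^s(\Omega)$ of the $v\in C^\infty(\overline\Omega)$ vanishing on $\partial\Omega$) or, for $s\in(\frac12,1)$ and a codimension-one set $\widetilde\Gamma$, $H^s_{\widetilde\Gamma^C}(\Omega)$ (closure of the $v\in C^\infty(\overline\Omega)$ vanishing on $\partial\Omega\setminus\widetilde\Gamma$). $H^*$ is its dual, $\langle\cdot,\cdot\rangle$ the duality pairing (extending the $L^2$ inner product). Functions are extended by $0$ to $\mathbb{R}^n\setminus\overline\Omega$, and $$a(u,v)=\frac{c_{n,s}}2\iint_{(\Omega\times\mathbb{R}^n)\cup(\mathbb{R}^n\times\Omega)}\frac{(u(x)-u(y))(v(x)-v(y))}{|x-y|^{n+2s}}\,dy\,dx,\qquad c_{n,s}=\frac{2^{2s}s\,\Gamma(\frac{n+2s}2)}{\pi^{n/2}\Gamma(1-s)}.$$ Standing fact: $a$ is continuous and coercive on $H$: $a(u,v)\le C\|u\|_H\|v\|_H$, $a(u,u)\ge\alpha\|u\|_H^2$. The bilinear form $b$ on $H^*\times H$ is $b(\mu,v)=\langle\mu,v\rangle$ (so $\lambda=f-(-\Delta)^su$, where $\langle(-\Delta)^su,v\rangle=a(u,v)$).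 $\mathbb{V}_h\subset H$ is the space of continuous piecewise linear functions in $H$ on a shape-regular triangulation $\mathcal{T}_h$ of $\Omega$, and $\mathbb{M}_H\subset H^*$ is the space of piecewise constant functions on a triangulation $\mathcal{T}_H$, acting on $H$ through the $L^2$ pairing (for problems with constraints on $\widetilde\Gamma$, piecewise constants on $\widetilde\Gamma$ acting through the trace on $\widetilde\Gamma$). $X\lesssim Y$ means $X\le C'Y$ with $C'>0$ independent of the mesh sizes, the data and the solutions. *)

(* Defs.v *)
From HB Require Import structures.
From mathcomp Require Import all_boot all_order all_algebra.
From mathcomp Require Import all_classical all_reals all_analysis.
Set Implicit Arguments. Unset Strict Implicit. Unset Printing Implicit Defensive.
Import Order.TTheory GRing.Theory Num.Theory.
Import numFieldNormedType.Exports.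
Local Open Scope classical_set_scope.
Local Open Scope ring_scope.

(* R^n is 'rV[R]_n for R : realType; Omega lives in R^n.+1, so that the dimension
   is at least 1. *)

(* The Borel sigma-algebra of R^n, generated by the coordinates as the library
   does for n.-tuple. *)
Definition measure_rV_display : measure_display.
Proof. exact: default_measure_display. Qed.

Section measurable_rV.
Context {R : realType} {n : nat}.

Definition rV_coord (i : 'I_n) (x : 'rV[R]_n) : R := x ord0 i.

Let rV_set0 : g_sigma_preimage rV_coord set0.
Proof. exact: sigma_algebra0. Qed.

Let rV_setC A : g_sigma_preimage rV_coord A -> g_sigma_preimage rV_coord (~` A).
Proof. exact: sigma_algebraC. Qed.

Let rV_bigcup (F : _^nat) : (forall i, g_sigma_preimage rV_coord (F i)) ->
  g_sigma_preimage rV_coord (\bigcup_i (F i)).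
Proof. exact: sigma_algebra_bigcup. Qed.

HB.instance Definition _ := @isMeasurable.Build measure_rV_display
  'rV[R]_n (g_sigma_preimage rV_coord) rV_set0 rV_setC rV_bigcup.

End measurable_rV.

Section measurable_rV_theory.
Context {R : realType}.

Lemma measurable_rV_coord n (i : 'I_n) :
  measurable_fun [set: 'rV[R]_n] (rV_coord i).
Proof.
move=> _ Y mY; rewrite setTI; apply: sub_sigma_algebra => /=.
rewrite -bigcup_seq/=; exists i => /=; first by rewrite mem_index_enum.
by exists Y => //; rewrite setTI.
Qed.

Lemma measurable_fun_rVP d (T : measurableType d) n (f : T -> 'rV[R]_n) :
  (forall i, measurable_fun [set: T] (fun x => f x ord0 i)) ->
  measurable_fun [set: T] f.
Proof.
move=> mf; suff H : g_sigma_preimage (fun i => rV_coord i \o f) `<=` measurable.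
  by move=> _ A mA; apply: H; rewrite g_sigma_preimage_comp; exists A.
apply: smallest_sub; first exact: sigma_algebra_measurable.
rewrite -bigcup_seq; apply: bigcup_sub => i _.
by move=> A [B mB <-]; exact: mf.
Qed.

Definition rV_cons n (p : R * 'rV[R]_n) : 'rV[R]_n.+1 := row_mx p.1%:M p.2.

Lemma measurable_rV_cons n : measurable_fun [set: R * 'rV[R]_n] (@rV_cons n).
Proof.
apply: measurable_fun_rVP => i.
rewrite /rV_cons; case: (@splitP 1 n i) => j ij.
  rewrite (_ : (fun _ => _) = fst); first exact: measurable_fst.
  apply/funext => -[x y] /=; have -> : i = @lshift 1 n j by exact/val_inj.
  by rewrite (row_mxEl x%:M) (ord1 j) mxE eqxx mulr1n.
rewrite (_ : (fun _ => _) = rV_coord j \o snd).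
  by apply: measurableT_comp; [exact: measurable_rV_coord|exact: measurable_snd].
apply/funext => -[x y] /=; have -> : i = @rshift 1 n j by exact/val_inj.
by rewrite (row_mxEr x%:M).
Qed.

Definition rV_uncons n (x : 'rV[R]_n.+1) : R * 'rV[R]_n :=
  (x ord0 ord0, @rsubmx R 1 1 n x).

Lemma rV_consK n : cancel (@rV_cons n) (@rV_uncons n).
Proof.
move=> [x y]; rewrite /rV_uncons /rV_cons /=; congr pair; last first.
  exact: (@row_mxKr R 1 1 n).
have -> : ord0 = @lshift 1 n ord0 by exact/val_inj.
by rewrite (row_mxEl x%:M) mxE eqxx mulr1n.
Qed.

Lemma measurable_rV_uncons n : measurable_fun [set: 'rV[R]_n.+1] (@rV_uncons n).
Proof.
apply: measurable_fun_pair; first exact: (measurable_rV_coord ord0).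
apply: measurable_fun_rVP => i.
rewrite (_ : (fun _ => _) = rV_coord (@rshift 1 n i)).
  exact: measurable_rV_coord.
by apply/funext => x; rewrite mxE.
Qed.

(* One step of the construction of Lebesgue measure on R^n: the product of the
   one-dimensional measure with a measure m on R^n, carried over to R^n.+1. *)
Section lebesgue_rVS.
Local Open Scope ereal_scope.
Variables (n : nat) (m : {sigma_finite_measure set 'rV[R]_n -> \bar R}).

Definition lebesgue_rVS (A : set 'rV[R]_n.+1) : \bar R :=
  (@lebesgue_measure R \x m) (@rV_cons n @^-1` A).

Let mcons (A : set 'rV[R]_n.+1) : measurable A ->
  measurable (@rV_cons n @^-1` A).
Proof.
by move=> mA; rewrite -[X in measurable X]setTI; exact: measurable_rV_cons.
Qed.

Let lebesgue_rVS0 : lebesgue_rVS set0 = 0.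
Proof. by rewrite /lebesgue_rVS preimage_set0 measure0. Qed.

Let lebesgue_rVS_ge0 A : 0 <= lebesgue_rVS A.
Proof. exact: measure_ge0. Qed.

Let lebesgue_rVS_sigma_additive : semi_sigma_additive lebesgue_rVS.
Proof.
move=> F mF tF mUF; rewrite /lebesgue_rVS preimage_bigcup.
apply: measure_semi_sigma_additive.
- by move=> k; exact: mcons.
- apply/trivIsetP => /= i j _ _ ij; rewrite -preimage_setI.
  by move/trivIsetP : tF => /(_ _ _ _ _ ij) ->//; rewrite preimage_set0.
- by rewrite -preimage_bigcup; exact: mcons.
Qed.

HB.instance Definition _ := isMeasure.Build _ _ _ lebesgue_rVS
  lebesgue_rVS0 lebesgue_rVS_ge0 lebesgue_rVS_sigma_additive.

Let lebesgue_rVS_sigma_finite : sigma_finite setT lebesgue_rVS.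
Proof.
have /sigma_finiteP[F [TF ndF Foo]] := sigma_finiteT (@lebesgue_measure R).
have /sigma_finiteP[G [TG ndG Goo]] := sigma_finiteT m.
exists (fun k => @rV_uncons n @^-1` (F k `*` G k)).
  rewrite -preimage_bigcup (_ : \bigcup_k _ = setT) ?preimage_setT//.
  rewrite -subTset => -[x y] _.
  have [i _ Fix] : (\bigcup_k F k) x by rewrite -TF.
  have [j _ Gjy] : (\bigcup_k G k) y by rewrite -TG.
  exists (maxn i j) => //; split => /=.
    by move: x Fix; exact/subsetPset/ndF/leq_maxl.
  by move: y Gjy; exact/subsetPset/ndG/leq_maxr.
move=> k; have [mF Fk] := Foo k; have [mG Gk] := Goo k; split.
  rewrite -[X in measurable X]setTI; apply: measurable_rV_uncons => //.
  exact: measurableX.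
rewrite /lebesgue_rVS -comp_preimage (_ : _ \o _ = id); last first.
  by apply/funext; exact: rV_consK.
by rewrite preimage_id product_measure1E// lte_mul_pinfty// ge0_fin_numE.
Qed.

HB.instance Definition _ := Measure_isSigmaFinite.Build _ _ _ lebesgue_rVS
  lebesgue_rVS_sigma_finite.

End lebesgue_rVS.

Fixpoint lebesgue_rV n : {sigma_finite_measure set 'rV[R]_n -> \bar R} :=
  if n is n'.+1 then lebesgue_rVS (lebesgue_rV n') else \d_(0 : 'rV[R]_0).

End measurable_rV_theory.

Notation "'leb[ R ]_ n" := (@lebesgue_rV R n)
  (at level 8, R at level 2, n at level 2, format "''leb[' R ]_ n").

Section euclidean.
Context {R : realType} {n : nat}.
Implicit Types x y : 'rV[R]_n.

(* The library's `|x| on 'rV[R]_n is the sup norm. *)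
Definition dotp x y : R := \sum_(i < n) x ord0 i * y ord0 i.
Definition enorm x : R := Num.sqrt (dotp x x).
Definition eball (c : 'rV[R]_n) (r : R) : set 'rV[R]_n :=
  [set x | enorm (x - c) < r].

Definition diam (A : set 'rV[R]_n) : R :=
  sup [set enorm (p.1 - p.2) | p in A `*` A].
Definition inradius (A : set 'rV[R]_n) : R :=
  sup [set r | exists c, eball c r `<=` A].

Definition boundary (A : set 'rV[R]_n) : set 'rV[R]_n := closure A `\` A°.

Definition zero_ext (A : set 'rV[R]_n) (u : 'rV[R]_n -> R) : 'rV[R]_n -> R :=
  patch (fun=> 0) A u.

End euclidean.

(* A k-simplex in R^n is given by the matrix whose k.+1 rows are its vertices;
   t *m V is then the point with barycentric coordinates t. *)
Section simplices.
Context {R : realType} {k n : nat}.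
Implicit Types (V : 'M[R]_(k.+1, n)) (T : seq 'M[R]_(k.+1, n)).

Definition affinely_free V : bool :=
  row_free (row_mx (const_mx 1 : 'cV[R]_k.+1) V).

(* The face spanned by the vertices in J; it is empty when J is. *)
Definition face V (J : {set 'I_k.+1}) : set 'rV[R]_n :=
  [set t *m V | t in [set t : 'rV[R]_k.+1 |
    [/\ forall i, 0 <= t ord0 i, \sum_i t ord0 i = 1 &
        forall i, i \notin J -> t ord0 i = 0]]].

Definition simplex V : set 'rV[R]_n := face V [set: 'I_k.+1]%SET.

(* The relative interior. *)
Definition open_simplex V : set 'rV[R]_n :=
  [set t *m V | t in [set t : 'rV[R]_k.+1 |
    (forall i, 0 < t ord0 i) /\ \sum_i t ord0 i = 1]].

Definition cells T : set 'rV[R]_n := \bigcup_(V in [set` T]) simplex V.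

Definition triangulation (G : set 'rV[R]_n) T : Prop :=
  [/\ forall V, V \in T -> affinely_free V,
      forall V W, V \in T -> W \in T -> exists J K,
        simplex V `&` simplex W = face V J /\
        simplex V `&` simplex W = face W K &
      closure G = cells T].

Definition shape_regular (sigma : R) T : Prop :=
  forall V, V \in T -> diam (simplex V) <= sigma * inradius (simplex V).

End simplices.

Section domains.
Context {R : realType} {n : nat}.
Local Notation E := 'rV[R]_n.+1.

(* Near every boundary point, Omega lies strictly on one side of the graph of a
   Lipschitz function g over the hyperplane orthogonal to a unit vector e; g is
   only evaluated at orthogonal projections onto that hyperplane. *)
Definition lipschitz_boundary (Omega : set E) : Prop :=
  forall x, boundary Omega x ->
  exists (r : R) (e : E) (g : E -> R) (L : R),
    [/\ 0 < r, enorm e = 1,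
        forall y z, `|g y - g z| <= L * enorm (y - z) &
        forall y, eball x r y ->
          (Omega y <-> g (y - dotp y e *: e) < dotp y e)].

Definition polygonal_boundary (Omega : set E) : Prop :=
  exists F : seq 'M[R]_(n.+1, n.+1),
    (forall V, V \in F -> affinely_free V) /\ boundary Omega = cells F.

Definition polygonal_lipschitz_domain (Omega : set E) : Prop :=
  [/\ open Omega, connected Omega, Omega !=set0, bounded_set Omega &
      lipschitz_boundary Omega /\ polygonal_boundary Omega].

(* Polyhedral of dimension n in R^n.+1; whether G contains (some of) the relative
   boundaries of its facets is left open. *)
Definition codimension_one (G : set E) : Prop :=
  G !=set0 /\
  exists F : seq 'M[R]_(n.+1, n.+1),
    [/\ forall V, V \in F -> affinely_free V,
        \bigcup_(V in [set` F]) open_simplex V `<=` G & G `<=` cells F].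

End domains.

Section sobolev.
Context {R : realType} {n : nat}.
Local Notation E := 'rV[R]_n.+1.
Local Notation leb := 'leb[R]_n.+1.
Implicit Types (s : R) (Omega G : set E) (u v : E -> R).

Definition partial (i : 'I_n.+1) (f : E -> R) : E -> R :=
  fun x => 'D_(delta_mx ord0 i) f x.

(* All iterated partial derivatives exist and are continuous.  The elements of
   C^oo(closure Omega) are the restrictions of such functions. *)
Definition smooth (f : E -> R) : Prop :=
  forall l : seq 'I_n.+1, let g := foldr partial f l in
    continuous g /\ forall i x, derivable g x (delta_mx ord0 i).

Definition riesz_kernel s (x y : E) : R :=
  (enorm (x - y) `^ (n.+1%:R + 2 * s))^-1.

(* The square of the Gagliardo seminorm |v|_{H^s(Omega)}. *)
Definition gagliardo s Omega v : \bar R :=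
  (\int[leb \x leb]_(z in Omega `*` Omega)
     ((v z.1 - v z.2) ^+ 2 * riesz_kernel s z.1 z.2)%:E)%E.

Definition Hs_enorm s Omega v : \bar R :=
  ('N[leb]_2%:E [EFin \o zero_ext Omega v] + (gagliardo s Omega v) `^ 2^-1)%E.

Definition Hs_norm s Omega v : R := fine (Hs_enorm s Omega v).

(* Elements of H^s(Omega) are represented by functions on R^n.+1, whose values
   outside Omega are irrelevant; functions equal a.e. in Omega are at distance
   0. *)
Definition Hs s Omega : set (E -> R) :=
  [set v | measurable_fun Omega v /\ (Hs_enorm s Omega v < +oo)%E].

Definition Hs_vanishing s Omega (D : set E) : set (E -> R) :=
  [set v | Hs s Omega v /\
    forall e : R, 0 < e -> exists phi : E -> R,
      [/\ smooth phi, forall x, D x -> phi x = 0 &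
          (Hs_enorm s Omega (v \- phi)%R < e%:E)%E]].

Definition euler_gamma (z : R) : R :=
  \int[lebesgue_measure]_(t in `]0, +oo[) (t `^ (z - 1) * expR (- t)).

Definition c_ns s : R :=
  2 `^ (2 * s) * s * euler_gamma ((n.+1%:R + 2 * s) / 2) /
  (pi `^ (n.+1%:R / 2) * euler_gamma (1 - s)).

(* Extended-real valued: nothing is assumed about convergence of the integral. *)
Definition a_form s Omega u v : \bar R :=
  let ut := zero_ext Omega u in let vt := zero_ext Omega v in
  ((c_ns s / 2)%:E *
   \int[leb \x leb]_(z in (Omega `*` setT) `|` (setT `*` Omega))
     ((ut z.1 - ut z.2) * (vt z.1 - vt z.2) * riesz_kernel s z.1 z.2)%:E)%E.

End sobolev.

(* The topological dual of a space H of functions with (semi)norm N.  Only the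
   values of a functional on H matter. *)
Section dual.
Context {R : realType} {E : Type}.
Variables (N : (E -> R) -> R) (H : set (E -> R)).
Local Notation functional := ((E -> R) -> R).
Implicit Types (mu : functional) (L : set functional).

Definition dual : set functional :=
  [set mu |
    (forall (c : R) u v, H u -> H v ->
       mu (fun x => c * u x + v x) = c * mu u + mu v) /\
    exists C : R, forall v, H v -> `|mu v| <= C * N v].

Definition dual_norm mu : R :=
  sup [set `|mu v| / N v | v in [set v | H v /\ N v != 0]].

Definition dual_closed L : Prop :=
  forall mu, dual mu ->
  (forall e : R, 0 < e -> exists2 nu, L nu & dual_norm (mu \- nu) < e) -> L mu.

Definition dual_convex L : Prop := @convex_set R ((E -> R) -> R^o) L.

Definition b_form mu (v : E -> R) : R := mu v.

Definition inf_sup (beta : R) (M : set functional) (Vh : set (E -> R)) : Prop :=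
  forall mu, M mu ->
    beta * dual_norm mu <=
    sup [set b_form mu v / N v | v in [set v | Vh v /\ N v != 0]].

End dual.

(* DomainZero: H = H^s_0(Omega), multipliers on Omega;
   DomainPartial G: H = H^s_{G^C}(Omega), multipliers on Omega;
   SurfacePartial G: H = H^s_{G^C}(Omega), multipliers on the codimension-one
   set G, acting through the trace. *)
Variant setting (R : realType) (n : nat) :=
  | DomainZero
  | DomainPartial of set 'rV[R]_n.+1
  | SurfacePartial of set 'rV[R]_n.+1.
Arguments DomainZero {R n}.

Section discretization.
Context {R : realType} {n : nat}.
Local Notation E := 'rV[R]_n.+1.
Local Notation leb := 'leb[R]_n.+1.
Variables (s : R) (Omega : set E).

Definition admissible (cs : setting R n) : Prop :=
  match cs with
  | DomainZero => True
  | DomainPartial G | SurfacePartial G =>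
      [/\ 2^-1 < s, codimension_one G & G `<=` closure Omega]
  end.

Definition H_space (cs : setting R n) : set (E -> R) :=
  match cs with
  | DomainZero => Hs_vanishing s Omega (boundary Omega)
  | DomainPartial G | SurfacePartial G =>
      Hs_vanishing s Omega (boundary Omega `\` G)
  end.

Definition affine_on (A : set E) (v : E -> R) : Prop :=
  exists (c : R) (g : E), forall x, A x -> v x = c + dotp g x.

Definition P1_space (H : set (E -> R)) (T : seq 'M[R]_(n.+2, n.+1)) :
    set (E -> R) :=
  [set v | [/\ H v, {within closure Omega, continuous v} &
              forall V, V \in T -> affine_on (simplex V) v]].

(* Integral over an n-simplex in R^n.+1 w.r.t. surface measure, by the affine
   parametrization over the reference simplex of R^n, whose Jacobian is the root
   of the Gram determinant of the edges at the first vertex. *)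
Definition ref_simplex : set 'rV[R]_n :=
  [set t | (forall i, 0 <= t ord0 i) /\ \sum_i t ord0 i <= 1].

Definition chart (V : 'M[R]_(n.+1, n.+1)) (t : 'rV[R]_n) : E :=
  (row_mx (1 - \sum_i t ord0 i)%:M t : 'rV[R]_(1 + n)) *m V.

Definition jacobian_factor (V : 'M[R]_(n.+1, n.+1)) : R :=
  let B : 'M[R]_(n, n.+1) :=
    \matrix_(i < n, j < n.+1) (V (lift ord0 i) j - V ord0 j) in
  Num.sqrt (\det (B *m B^T)).

Definition facet_integral (V : 'M[R]_(n.+1, n.+1)) (f : E -> R) : \bar R :=
  ((jacobian_factor V)%:E *
   \int['leb[R]_n]_(t in ref_simplex) (f (chart V t))%:E)%E.

(* g is the trace of v on the union of the facets in T: the limit in L^2 of the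
   restrictions of smooth functions converging to v in H^s(Omega). *)
Definition is_trace (T : seq 'M[R]_(n.+1, n.+1)) (v g : E -> R) : Prop :=
  (forall V, V \in T -> measurable_fun ref_simplex (g \o chart V)) /\
  forall e : R, 0 < e -> exists phi : E -> R,
    [/\ smooth phi, (Hs_enorm s Omega (v \- phi)%R < e%:E)%E &
        (\sum_(V <- T) facet_integral V (fun x => (g x - phi x) ^+ 2)%R < e%:E)%E].

(* The L^2(Omega) pairing with the piecewise constant function equal to c V on
   the cell V. *)
Definition domain_multipliers (H : set (E -> R)) (T : seq 'M[R]_(n.+2, n.+1)) :
    set ((E -> R) -> R) :=
  [set mu | dual (Hs_norm s Omega) H mu /\
    exists c : 'M[R]_(n.+2, n.+1) -> R, forall v, H v ->
      mu v = \sum_(V <- T) c V * \int[leb]_(x in simplex V `&` Omega) v x].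

Definition surface_multipliers (H : set (E -> R)) (T : seq 'M[R]_(n.+1, n.+1)) :
    set ((E -> R) -> R) :=
  [set mu | dual (Hs_norm s Omega) H mu /\
    exists c : 'M[R]_(n.+1, n.+1) -> R, forall v g, H v -> is_trace T v g ->
      mu v = \sum_(V <- T) c V * fine (facet_integral V g)].

Definition multiplier_dim (cs : setting R n) : nat :=
  if cs is SurfacePartial _ then n else n.+1.

Definition multiplier_set (cs : setting R n) : set E :=
  if cs is SurfacePartial G then G else Omega.

Definition multiplier_space (cs : setting R n) :
    seq 'M[R]_((multiplier_dim cs).+1, n.+1) -> set ((E -> R) -> R) :=
  match cs return
    seq 'M[R]_((multiplier_dim cs).+1, n.+1) -> set ((E -> R) -> R) with
  | DomainZero => domain_multipliers (H_space DomainZero)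
  | DomainPartial G => domain_multipliers (H_space (DomainPartial G))
  | SurfacePartial G => surface_multipliers (H_space (SurfacePartial G))
  end.

End discretization.

(* Main.v *)
Require Import Defs.
From mathcomp Require Import all_boot all_order all_algebra.
From mathcomp Require Import all_classical all_reals all_analysis.
From mathcomp Require Import measurable_realfun ring lra.
Set Implicit Arguments. Unset Strict Implicit. Unset Printing Implicit Defensive.
Import Order.TTheory GRing.Theory Num.Theory.
Import numFieldNormedType.Exports.
Local Open Scope classical_set_scope.
Local Open Scope ring_scope.

(** Write [e = u - uh].  Subtracting the two state equations on [Vh] gives the
    Galerkin relation [a(e, v) = - <lam - lamH, v>] for [v] in [Vh].

    Primal error: the Galerkin relation, applied to [vh] and to [uh], yields
      [a(e, e) = a(e, u - vh) + <lam - lamH, u - vh> - <lam - lamH, e>],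
    so coercivity and continuity bound [alpha |e|^2] by a sum of products of two
    of the numbers [|e|], [|u - vh|] and [|lam - lamH|]; Young's inequality
    absorbs [|e|] on the left ([primal_error_estimate]).

    Multiplier error: the inf-sup condition applies to [muH - lamH], and the
    Galerkin relation rewrites [<muH - lamH, v>] as [<muH - lam, v> - a(e, v)];
    the triangle inequality in the dual concludes ([multiplier_error_estimate]).

    Both arguments are carried out for an abstract real bilinear form.  What
    remains is to see that the fractional Sobolev setting is an instance.
    - The trial spaces are closed under differences: both parts of the norm are
      L^2 norms, of the function and of its weighted difference quotient, so
      Minkowski's inequality applies ([Hs_enormB], [H_spaceB]).
    - The form is given by an extended-real integral, and bilinearity needs
      convergence.  The continuity hypothesis makes the diagonal values
      [a(u, u)] finite; if the constant c_{n,s} is positive, the integrand for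
      [u, v] is then dominated by the sum of those for [u, u] and [v, v]
      ([integrable_energy_density]).  If the constant is nonpositive, so is
      [a(u, u)], and coercivity makes every norm vanish
      ([a_form_le0_norm_eq0]): the estimates read [0 <= 0].
    All of this uses that open sets of R^n belong to the sigma-algebra generated
    by the coordinates ([open_measurable_rV]). *)

(** * Dual norms with respect to a seminorm on a set of functions *)

Section dual_norm.
Context {R : realType} {E : Type}.
Variables (N : (E -> R) -> R) (H : set (E -> R)).
Hypothesis N_ge0 : forall v, 0 <= N v.
Implicit Types (mu nu : (E -> R) -> R).

Let N_gt0 v : N v != 0 -> 0 < N v.
Proof. by rewrite lt0r N_ge0 andbT. Qed.

Lemma dual_sub mu nu : dual N H mu -> dual N H nu -> dual N H (mu \- nu).
Proof.
move=> [mul [C muC]] [nul [D nuD]]; split.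
  by move=> c u v Hu Hv /=; rewrite mul // nul //; ring.
exists (C + D) => v Hv /=; rewrite mulrDl.
by apply: le_trans (ler_normB _ _) _; rewrite lerD ?muC ?nuD.
Qed.

Lemma dualB mu u v : dual N H mu -> H u -> H v -> mu (u \- v) = mu u - mu v.
Proof.
move=> [mul _] Hu Hv.
have -> : u \- v = (fun x => -1 * v x + u x) by apply/funext => x /=; ring.
by rewrite mul //; ring.
Qed.

(** The supremum of an unbounded or empty set of reals is [0]. *)
Lemma dual_norm_ge0 mu : 0 <= dual_norm N H mu.
Proof.
rewrite /dual_norm; set S := [set _ | _ in _].
have [[[x Sx] ubS]|/sup_out -> //] := pselect (has_sup S).
apply: le_trans (ub_le_sup ubS Sx).
by case: Sx => v _ <-; exact: divr_ge0.
Qed.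

(** Elements of seminorm [0] are left out of the supremum; on them a continuous
    functional vanishes. *)
Lemma dual_norm_le mu v : dual N H mu -> H v -> `|mu v| <= dual_norm N H mu * N v.
Proof.
move=> [_ [C muC]] Hv; have [Nv0|Nv0] := eqVneq (N v) 0.
  by have := muC _ Hv; rewrite Nv0 !mulr0.
rewrite -ler_pdivrMr ?N_gt0 //.
apply: ub_le_sup; last by exists v.
exists C => _ [x [Hx Nx0] <-].
by rewrite ler_pdivrMr ?N_gt0 //; exact: muC.
Qed.

(** The assumption [0 <= c] covers the case where no element of [V] has a nonzero
    seminorm. *)
Lemma sup_quotient_le (V : set (E -> R)) mu (c : R) : 0 <= c ->
  (forall v, V v -> mu v <= c * N v) ->
  sup [set mu v / N v | v in [set v | V v /\ N v != 0]] <= c.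
Proof.
move=> c0 muc; set S := [set _ | _ in _].
have [->|S0] := eqVneq S set0; first by rewrite sup0.
apply: ge_sup; first exact/set0P.
by move=> _ [v [Vv Nv0] <-]; rewrite ler_pdivrMr ?N_gt0 //; exact: muc.
Qed.

Lemma dual_norm_triangle (la mu nu : (E -> R) -> R) :
  dual N H la -> dual N H mu -> dual N H nu ->
  dual_norm N H (la \- nu) <= dual_norm N H (la \- mu) + dual_norm N H (mu \- nu).
Proof.
move=> dla dmu dnu.
rewrite {1}/dual_norm; set S := [set `|_| / _ | _ in _].
have [->|S0] := eqVneq S set0.
  by rewrite sup0 addr_ge0 ?dual_norm_ge0.
apply: ge_sup; first exact/set0P.
move=> _ [v [Hv Nv0] <-]; rewrite ler_pdivrMr ?N_gt0 //.
have -> : (la \- nu) v = (la \- mu) v + (mu \- nu) v by rewrite /=; ring.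
apply: le_trans (ler_normD _ _) _; rewrite mulrDl.
by rewrite lerD // dual_norm_le //; exact: dual_sub.
Qed.

End dual_norm.

(** * The error estimates for an abstract bilinear form *)

(** The terms in [E] on the right are split with weight [alpha / 4] each, which
    leaves [alpha / 2 * E ^+ 2] on the left. *)
Lemma young_absorb (R : realFieldType) (alpha C E U L : R) : 0 < alpha ->
  alpha * E ^+ 2 <= C * E * U + L * U + L * E ->
  E ^+ 2 <= (2 * (C ^+ 2 / alpha + 1 / alpha + 1) / alpha) * (U ^+ 2 + L ^+ 2).
Proof.
move=> a0 h.
have a1 : 0 < alpha^-1 by rewrite invr_gt0.
have sq x y : x * y <= alpha / 4 * x ^+ 2 + y ^+ 2 / alpha.
  have := sqr_ge0 (alpha / 2 * x - y).
  have -> : (alpha / 2 * x - y) ^+ 2 =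
     alpha * (alpha / 4 * x ^+ 2 + y ^+ 2 / alpha - x * y) by field; rewrite gt_eqF.
  by rewrite pmulr_rge0 // subr_ge0.
have h1 := sq E (C * U); have h2 := sq E L.
have h3 : 2 * (L * U) <= L ^+ 2 + U ^+ 2 by have := sqr_ge0 (L - U); nra.
rewrite -(ler_pM2l a0).
have -> : alpha * (2 * (C ^+ 2 / alpha + 1 / alpha + 1) / alpha * (U ^+ 2 + L ^+ 2))
  = 2 * (C ^+ 2 / alpha + 1 / alpha + 1) * (U ^+ 2 + L ^+ 2) by field; rewrite gt_eqF.
have e1 : (C * U) ^+ 2 / alpha = C ^+ 2 / alpha * U ^+ 2 by ring.
rewrite e1 in h1.
have k1 : 0 <= C ^+ 2 / alpha * L ^+ 2 
  by apply: mulr_ge0; [apply: mulr_ge0; [exact: sqr_ge0|exact: ltW]|exact: sqr_ge0].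
have k2 : 0 <= U ^+ 2 / alpha 
  by apply: mulr_ge0; [exact: sqr_ge0|exact: ltW].
have l2 := sqr_ge0 L; have u2 := sqr_ge0 U.
(* What is left is linear in the monomials of the hypotheses. *)
set ia := alpha^-1 in a1 h1 h2 k1 k2 *.
lra.
Qed.

Section mixed_estimate.
Context {R : realType} {E : Type}.
Variables (N : (E -> R) -> R) (H : set (E -> R)).
Hypothesis N_ge0 : forall v, 0 <= N v.
Hypothesis HB : forall u v, H u -> H v -> H (u \- v).
Variables (A : (E -> R) -> (E -> R) -> R) (C alpha beta : R).
Hypothesis AC : forall u v, H u -> H v -> `|A u v| <= C * N u * N v.
Hypothesis Acoercive : forall u, H u -> alpha * N u ^+ 2 <= A u u.
Hypothesis ABl : forall u u' v, H u -> H u' -> H v ->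
  A (u \- u') v = A u v - A u' v.
Hypothesis ABr : forall u v v', H u -> H v -> H v' ->
  A u (v \- v') = A u v - A u v'.
Hypotheses (C_ge0 : 0 <= C) (alpha_gt0 : 0 < alpha) (beta_gt0 : 0 < beta).
Variables (Vh : set (E -> R)) (f la laH : (E -> R) -> R) (u uh : E -> R).
Hypotheses (VhH : Vh `<=` H) (Hu : H u) (Vuh : Vh uh).
Hypotheses (dla : dual N H la) (dlaH : dual N H laH).
Hypothesis u_sol : forall v, H v -> A u v + la v = f v.
Hypothesis uh_sol : forall v, Vh v -> A uh v + laH v = f v.

Lemma galerkin_orthogonality v : Vh v -> A (u \- uh) v = - (la \- laH) v.
Proof.
move=> Vv; have Hv := VhH Vv; rewrite ABl //; last exact: VhH.
by have := u_sol Hv; have := uh_sol Vv; rewrite /=; lra.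
Qed.

(** Writing [vh - uh] as [(u - uh) - (u - vh)] in the Galerkin relation leaves only
    errors to be bounded. *)
Lemma primal_error_estimate vh : Vh vh ->
  N (u \- uh) ^+ 2 <= (2 * (C ^+ 2 / alpha + 1 / alpha + 1) / alpha) *
    (N (u \- vh) ^+ 2 + dual_norm N H (la \- laH) ^+ 2).
Proof.
move=> Vvh; have Hvh := VhH Vvh; have Huh := VhH Vuh.
have He : H (u \- uh) by exact: HB.
have Hw : H (u \- vh) by exact: HB.
have dla' := dual_sub dla dlaH.
apply: young_absorb => //; apply: le_trans (Acoercive He) _.
have eqA : A (u \- uh) (u \- uh) = A (u \- uh) (u \- vh)
    + (la \- laH) (u \- vh) - (la \- laH) (u \- uh).
  rewrite !ABr // !(dualB dla') // (galerkin_orthogonality Vuh)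
    (galerkin_orthogonality Vvh); ring.
rewrite eqA; apply: lerD; first apply: lerD.
- by apply: le_trans (ler_norm _) _; exact: AC.
- by apply: le_trans (ler_norm _) _; exact: dual_norm_le.
- by apply: le_trans (ler_norm _) _; rewrite normrN; exact: dual_norm_le.
Qed.

(** The inf-sup condition controls the discrete part [muH - laH] of the error, the
    triangle inequality the rest. *)
Lemma multiplier_error_estimate (M : set ((E -> R) -> R)) muH :
  M `<=` dual N H -> inf_sup N H beta M Vh -> M (muH \- laH) -> dual N H muH ->
  dual_norm N H (la \- laH) <=
    (1 + 1 / beta + C / beta) * (N (u \- uh) + dual_norm N H (la \- muH)).
Proof.
move=> MH ish MmuH dmuH; have Huh := VhH Vuh.
have He : H (u \- uh) by exact: HB.
have d1 := dual_sub dla dmuH.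
have E0 := N_ge0 (u \- uh).
have M0 : 0 <= dual_norm N H (la \- muH) by exact: dual_norm_ge0.
have hbeta : beta * dual_norm N H (muH \- laH) <=
    dual_norm N H (la \- muH) + C * N (u \- uh).
  apply: le_trans (ish _ MmuH) _.
  apply: sup_quotient_le => //; first by rewrite addr_ge0 ?mulr_ge0.
  move=> v Vv; have Hv := VhH Vv; rewrite /b_form.
  have -> : (muH \- laH) v = - (la \- muH) v - A (u \- uh) v.
    by rewrite galerkin_orthogonality //=; ring.
  rewrite mulrDl; apply: lerD.
    by apply: le_trans (ler_norm _) _; rewrite normrN; exact: dual_norm_le.
  by apply: le_trans (ler_norm _) _; rewrite normrN; exact: AC.
apply: le_trans (dual_norm_triangle N_ge0 dla dmuH dlaH) _.
have : dual_norm N H (muH \- laH) <=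
    (dual_norm N H (la \- muH) + C * N (u \- uh)) / beta.
  by rewrite ler_pdivlMr // mulrC.
have b1 : 0 < beta^-1 by rewrite invr_gt0.
have k1 : 0 <= N (u \- uh) / beta by apply: mulr_ge0 => //; exact: ltW.
have k2 : 0 <= C / beta * dual_norm N H (la \- muH) 
  by apply: mulr_ge0 => //; apply: mulr_ge0 => //; exact: ltW.
set m := dual_norm _ _ (la \- muH) in M0 k2 *.
set ib := beta^-1 in b1 k1 k2 *.
lra.
Qed.

End mixed_estimate.

(** * Measurability in R^n *)

Section measurability.
Context {R : realType}.

(** An open set is the union of the boxes with rational centre and radius
    [1 / (k + 1)] that it contains; there are countably many of them, and each is
    a finite intersection of slabs. *)
Lemma open_measurable_rV n (U : set 'rV[R]_n) : open U -> measurable U.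
Proof.
move=> oU.
pose box (p : 'rV[rat]_n * nat) : set 'rV[R]_n :=
  \bigcap_(i in [set` index_enum 'I_n])
    rV_coord i @^-1` ball (ratr (p.1 ord0 i) : R) p.2.+1%:R^-1.
have mbox p : measurable (box p).
  rewrite /box bigcap_seq; apply: bigsetI_measurable => i _.
  rewrite -[X in measurable X]setTI.
  by apply: measurable_rV_coord => //; exact: measurable_ball.
rewrite (_ : U = \bigcup_(p : 'rV[rat]_n * nat)
    if pselect (box p `<=` U) then box p else set0); last first.
  apply/seteqP; split => x; last first.
    by move=> [p _]; case: pselect => // pU /pU.
  move=> Ux; have /nbhs_ballP[e /= e0 eU] : nbhs x U by exact: open_nbhs_nbhs.
  (* Both the point of [U] and any point of the box are within [e / 2] of the
     centre. *)
  have [k ke] : exists k : nat, k.+1%:R^-1 < e / 2.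
    have e2 : 0 < e / 2 by rewrite divr_gt0.
    exists (Num.bound (e / 2)^-1); rewrite invf_plt ?posrE //.
    have e2i : 0 <= (e / 2)^-1 by rewrite invr_ge0 ltW.
    apply: lt_le_trans (archi_boundP e2i) _; by rewrite ler_nat.
  have k0 : 0 < k.+1%:R^-1 :> R by [].
  have /choice[q xq] i : exists q : rat, `|ratr q - x ord0 i| < k.+1%:R^-1.
    have : x ord0 i - k.+1%:R^-1 < x ord0 i + k.+1%:R^-1.
      by rewrite ltrD2l gtrN.
    move=> /rat_in_itvoo[q]; rewrite in_itv /= => /andP[q1 q2].
    by exists q; rewrite ltr_distl q1 q2.
  exists (\row_i q i, k) => //; case: pselect => [pU|[]] /=.
    move=> i _; change (ball (ratr ((\row_j q j) ord0 i) : R) k.+1%:R^-1 (x ord0 i)).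
    by rewrite mxE; exact: xq.
  move=> y py; apply: eU; split => // i j; rewrite {i}(ord1 i).
  have : ball (ratr ((\row_i q i) ord0 j) : R) k.+1%:R^-1 (y ord0 j).
    by apply: py; exact: mem_index_enum.
  rewrite mxE /ball /= => yq.
  have := ler_normD (x ord0 j - ratr (q j)) (ratr (q j) - y ord0 j).
  rewrite subrKA => /le_lt_trans; apply.
  rewrite [ltRHS]splitr; apply: ltrD; first by rewrite distrC (lt_trans (xq j)).
  exact: lt_trans yq ke.
apply: countable_bigcupT_measurable; first exact: countableP.
by move=> p; case: pselect => [pU|npU] /=; [exact: mbox|exact: measurable0].
Qed.

Lemma continuous_measurable_rV n (f : 'rV[R]_n -> R) :
  continuous f -> measurable_fun [set: 'rV[R]_n] f.
Proof.
move=> cf; apply: (measurability _ (RGenOpens.measurableE R)) => //.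
move=> _ [_ [a [b ->]] <-]; rewrite setTI; apply: open_measurable_rV.
by apply: open_comp; [move=> x _; exact: cf|exact: interval_open].
Qed.

Lemma measurable_enorm n : measurable_fun [set: 'rV[R]_n] enorm.
Proof.
apply: (@measurableT_comp _ _ _ _ _ _ (@Num.sqrt R)).
  by apply: continuous_measurable_fun; exact: sqrt_continuous.
rewrite /dotp; apply: measurable_sum => i.
by apply: measurable_funM; exact: measurable_rV_coord.
Qed.

Lemma measurable_riesz_kernel n (s : R) : measurable_fun setT
  (fun z : 'rV[R]_n.+1 * 'rV[R]_n.+1 => riesz_kernel s z.1 z.2).
Proof.
rewrite (_ : (fun _ => _) = fun z => enorm (z.1 - z.2) `^ (- (n.+1%:R + 2 * s))).
  2: by apply/funext => z; rewrite powRN.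
apply: (@measurableT_comp _ _ _ _ _ _ (@powR R ^~ (- (n.+1%:R + 2 * s)))).
  exact: measurable_powR.
apply: measurableT_comp; first exact: measurable_enorm.
apply: measurable_fun_rVP => i.
rewrite (_ : (fun _ => _) = (rV_coord i \o fst) \- (rV_coord i \o snd)).
  apply: measurable_funB; apply: measurableT_comp;
    do ?[exact: measurable_rV_coord|exact: measurable_fst|exact: measurable_snd].
by apply/funext => z; rewrite /= !mxE.
Qed.

Lemma riesz_kernel_ge0 n (s : R) (x y : 'rV[R]_n.+1) : 0 <= riesz_kernel s x y.
Proof. by rewrite invr_ge0 powR_ge0. Qed.

Lemma measurable_difference n (u : 'rV[R]_n -> R) : measurable_fun setT u ->
  measurable_fun setT (fun z : 'rV[R]_n * 'rV[R]_n => u z.1 - u z.2).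
Proof.
move=> mu; apply: measurable_funB;
  apply: (measurableT_comp mu); [exact: measurable_fst|exact: measurable_snd].
Qed.

End measurability.

(** * The fractional Sobolev spaces are closed under differences *)

Section fractional_sobolev.
Context {R : realType} {n : nat}.
Local Notation E := 'rV[R]_n.+1.
Local Notation leb := 'leb[R]_n.+1.
Variables (s : R) (Omega : set E).
Hypothesis mOmega : measurable Omega.
Implicit Types u v phi psi : E -> R.

Lemma zero_extB u v :
  zero_ext Omega (u \- v) = zero_ext Omega u \- zero_ext Omega v.
Proof.
by apply/funext => x; rewrite /zero_ext /patch /=; case: ifP; rewrite ?subr0.
Qed.

Lemma measurable_zero_ext u :
  measurable_fun Omega u -> measurable_fun setT (zero_ext Omega u).
Proof. by move=> mu; exact/(measurable_restrictT u mOmega). Qed.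

(** The function of two variables whose L^2 norm is the Gagliardo seminorm.  The
    extension by zero makes it measurable on the whole product. *)
Definition difference_quotient u : E * E -> R :=
  patch (fun=> 0) (Omega `*` Omega) (fun z =>
    (zero_ext Omega u z.1 - zero_ext Omega u z.2) *
    Num.sqrt (riesz_kernel s z.1 z.2)).

Lemma measurable_difference_quotient u :
  measurable_fun Omega u -> measurable_fun setT (difference_quotient u).
Proof.
move=> mu; apply/(measurable_restrictT _ (measurableX mOmega mOmega)).
apply: measurable_funTS; apply: measurable_funM.
  exact: (measurable_difference (measurable_zero_ext mu)).
apply: (@measurableT_comp _ _ _ _ _ _ (@Num.sqrt R)).
  by apply: continuous_measurable_fun; exact: sqrt_continuous.
exact: measurable_riesz_kernel.
Qed.

Lemma difference_quotientB u v : difference_quotient (u \- v) =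
  difference_quotient u \- difference_quotient v.
Proof.
apply/funext => z; rewrite /difference_quotient /patch /= zero_extB.
by case: ifP => _; rewrite ?subr0 //=; ring.
Qed.

Lemma gagliardo_Lnorm u : (gagliardo s Omega u `^ 2^-1)%E =
  ('N[leb \x leb]_2%:E [EFin \o difference_quotient u])%E.
Proof.
rewrite unlock /gagliardo; congr (_ `^ _)%E; rewrite [LHS]integral_mkcond.
apply: eq_integral => z _; rewrite /difference_quotient /patch /=.
rewrite powR_mulrn // real_normK ?num_real //.
case: ifP => [/set_mem [/= z1 z2]|_]; last by rewrite expr0n.
congr EFin.
rewrite /zero_ext /patch !mem_set // exprMn sqr_sqrtr //.
exact: riesz_kernel_ge0.
Qed.

Lemma Hs_enorm_ge0 u : (0 <= Hs_enorm s Omega u)%E.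
Proof. by rewrite /Hs_enorm adde_ge0 ?Lnorm_ge0 ?poweR_ge0. Qed.

Lemma Hs_norm_ge0 u : 0 <= Hs_norm s Omega u.
Proof. exact/fine_ge0/Hs_enorm_ge0. Qed.

Let Lnorm2B d (T : measurableType d) (mu : {measure set T -> \bar R})
    (f g : T -> R) : measurable_fun setT f -> measurable_fun setT g ->
  ('N[mu]_2%:E [EFin \o (f \- g)%R] <=
   'N[mu]_2%:E [EFin \o f] + 'N[mu]_2%:E [EFin \o g])%E.
Proof.
move=> mf mg; rewrite -[X in (_ <= _ + X)%E]oppe_Lnorm.
apply: (@minkowski_EFin _ _ _ mu f (\- g)%R) => //; last by rewrite ler1n.
exact: measurable_funN.
Qed.

Let Lnorm2C d (T : measurableType d) (mu : {measure set T -> \bar R})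
    (f g : T -> R) :
  ('N[mu]_2%:E [EFin \o (f \- g)%R] = 'N[mu]_2%:E [EFin \o (g \- f)%R])%E.
Proof.
rewrite -oppe_Lnorm; congr Lnorm; apply/funext => x /=.
by rewrite opprB.
Qed.

Lemma Hs_enormB u v : measurable_fun Omega u -> measurable_fun Omega v ->
  (Hs_enorm s Omega (u \- v)%R <= Hs_enorm s Omega u + Hs_enorm s Omega v)%E.
Proof.
move=> mu mv; rewrite /Hs_enorm !gagliardo_Lnorm zero_extB difference_quotientB.
rewrite addeACA; apply: leeD; apply: Lnorm2B;
  do ?[exact: measurable_zero_ext|exact: measurable_difference_quotient].
Qed.

Lemma Hs_normC u v : Hs_norm s Omega (u \- v) = Hs_norm s Omega (v \- u).
Proof.
rewrite /Hs_norm /Hs_enorm !gagliardo_Lnorm !zero_extB !difference_quotientB.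
by congr (fine (_ + _)%E); exact: Lnorm2C.
Qed.

Lemma smoothB phi psi : smooth phi -> smooth psi -> smooth (phi \- psi).
Proof.
move=> sphi spsi l /=.
have -> : foldr partial (phi \- psi) l = foldr partial phi l \- foldr partial psi l.
  elim: l => //= i l ->; apply/funext => x; rewrite /partial deriveB //.
    exact: (sphi l).2.
  exact: (spsi l).2.
have [cphi dphi] := sphi l; have [cpsi dpsi] := spsi l.
split=> [x|i x]; first exact: continuousB (cphi x) (cpsi x).
by apply: derivableB; [exact: dphi|exact: dpsi].
Qed.

(** Differences of the smooth approximations approximate the difference. *)
Lemma Hs_vanishingB (D : set E) u v : Hs_vanishing s Omega D u ->
  Hs_vanishing s Omega D v -> Hs_vanishing s Omega D (u \- v).
Proof.
move=> [[mu fu] au] [[mv fv] av].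
split.
  split; first exact: measurable_funB.
  by apply: le_lt_trans (Hs_enormB mu mv) _; rewrite lte_add_pinfty.
move=> e e0; have e2 : 0 < e / 2 by rewrite divr_gt0.
have [phi [sphi phi0 uphi]] := au _ e2; have [psi [spsi psi0 vpsi]] := av _ e2.
exists (phi \- psi); split; first exact: smoothB.
  by move=> x Dx /=; rewrite phi0 // psi0 // subrr.
have msm (f : E -> R) : smooth f -> measurable_fun Omega f.
  move=> sf; apply: measurable_funTS; apply: continuous_measurable_rV.
  exact: (sf [::]).1.
rewrite (_ : (u \- v) \- (phi \- psi) = (u \- phi) \- (v \- psi)); last first.
  by apply/funext => x /=; ring.
apply: le_lt_trans (Hs_enormB _ _) _.
- by apply: measurable_funB => //; exact: msm.
- by apply: measurable_funB => //; exact: msm.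
by rewrite [e]splitr EFinD; exact: lteD.
Qed.

Lemma H_spaceB (cs : setting R n) u v : H_space s Omega cs u ->
  H_space s Omega cs v -> H_space s Omega cs (u \- v).
Proof. by case: cs => [|G|G]; exact: Hs_vanishingB. Qed.

Lemma H_space_measurable (cs : setting R n) u :
  H_space s Omega cs u -> measurable_fun Omega u.
Proof. by case: cs => [|G|G] -[[]]. Qed.

End fractional_sobolev.

(** * Convergence and bilinearity of the form *)

Section bilinear_form.
Context {R : realType} {n : nat}.
Local Notation E := 'rV[R]_n.+1.
Local Notation leb := 'leb[R]_n.+1.
Variables (s : R) (Omega : set E).
Hypothesis mOmega : measurable Omega.
Implicit Types u v w : E -> R.

Let D : set (E * E) := (Omega `*` setT) `|` (setT `*` Omega).

Let mD : measurable D.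
Proof. by apply: measurableU; exact: measurableX. Qed.

Definition energy_density u v (z : E * E) : R :=
  (zero_ext Omega u z.1 - zero_ext Omega u z.2) *
  (zero_ext Omega v z.1 - zero_ext Omega v z.2) * riesz_kernel s z.1 z.2.

Lemma a_formE u v : a_form s Omega u v =
  ((c_ns (n := n) s / 2)%:E * \int[leb \x leb]_(z in D) (energy_density u v z)%:E)%E.
Proof. by []. Qed.

Lemma a_formC u v : a_form s Omega u v = a_form s Omega v u.
Proof.
rewrite !a_formE; congr (_ * _)%E; apply: eq_integral => z _.
by congr EFin; rewrite /energy_density; ring.
Qed.

Lemma energy_density_ge0 u z : 0 <= energy_density u u z.
Proof. by rewrite mulr_ge0 ?riesz_kernel_ge0 // -expr2 sqr_ge0. Qed.

Lemma measurable_energy_density u v : measurable_fun Omega u ->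
  measurable_fun Omega v -> measurable_fun setT (energy_density u v).
Proof.
move=> mu mv; apply: measurable_funM; last exact: measurable_riesz_kernel.
apply: measurable_funM.
  exact: (measurable_difference (measurable_zero_ext mOmega mu)).
exact: (measurable_difference (measurable_zero_ext mOmega mv)).
Qed.

Lemma energy_integral_ge0 u :
  (0 <= \int[leb \x leb]_(z in D) (energy_density u u z)%:E)%E.
Proof. by apply: integral_ge0 => z _; rewrite lee_fin energy_density_ge0. Qed.

Lemma a_form_le0 u : c_ns (n := n) s <= 0 -> (a_form s Omega u u <= 0)%E.
Proof.
move=> c0; rewrite a_formE; apply: mule_le0_ge0; last exact: energy_integral_ge0.
by rewrite lee_fin; lra.
Qed.

Hypothesis c_gt0 : 0 < c_ns (n := n) s.

Definition finite_energy u : Prop :=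
  measurable_fun Omega u /\ (a_form s Omega u u < +oo)%E.

(** On the diagonal the integrand is nonnegative, and a positive factor cannot
    turn an infinite integral into a finite value. *)
Lemma integrable_energy_density_diag u : finite_energy u ->
  (leb \x leb)%E.-integrable D (EFin \o energy_density u u).
Proof.
move=> [mu fu]; apply/integrableP; split.
  apply/measurable_EFinP; apply: measurable_funTS.
  exact: measurable_energy_density.
rewrite (eq_integral (fun z => (energy_density u u z)%:E)); last first.
  by move=> z _ /=; rewrite ger0_norm ?energy_density_ge0.
move: fu; rewrite a_formE !ltey; apply: contra => /eqP ->.
by rewrite gt0_muley // lte_fin divr_gt0.
Qed.

(** By [`|x * y| <= x ^+ 2 + y ^+ 2]. *)
Lemma integrable_energy_density u v : finite_energy u -> finite_energy v ->
  (leb \x leb)%E.-integrable D (EFin \o energy_density u v).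
Proof.
move=> fu fv; have [mu _] := fu; have [mv _] := fv.
have iuv := integrableD mD (integrable_energy_density_diag fu)
  (integrable_energy_density_diag fv).
apply: le_integrable iuv => //.
  apply/measurable_EFinP; apply: measurable_funTS.
  exact: measurable_energy_density.
move=> z _ /=; rewrite lee_fin [leRHS]ger0_norm ?addr_ge0 ?energy_density_ge0 //.
rewrite /energy_density; set x := zero_ext _ u _ - _; set y := zero_ext _ v _ - _.
rewrite normrM (ger0_norm (riesz_kernel_ge0 _ _ _)) -mulrDl.
rewrite ler_wpM2r ?riesz_kernel_ge0 // ler_norml.
by apply/andP; split; have := sqr_ge0 (x + y); have := sqr_ge0 (x - y); nra.
Qed.

Lemma a_form_fin_num u v : finite_energy u -> finite_energy v ->
  a_form s Omega u v \is a fin_num.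
Proof.
move=> fu fv; rewrite a_formE fin_numM // integrable_fin_num //.
exact: integrable_energy_density.
Qed.

Lemma a_formBl u v w : finite_energy u -> finite_energy v -> finite_energy w ->
  a_form s Omega (u \- v)%R w = (a_form s Omega u w - a_form s Omega v w)%E.
Proof.
move=> fu fv fw; rewrite !a_formE -muleBr //; last first.
  by rewrite fin_num_adde_defr // integrable_fin_num //;
     exact: integrable_energy_density.
rewrite -integralB_EFin //; do ?exact: integrable_energy_density.
congr (_ * _)%E; apply: eq_integral => z _.
by rewrite -EFinB /energy_density zero_extB /=; congr EFin; ring.
Qed.

End bilinear_form.

(** In this case [a(u, u)] is nonpositive, against coercivity. *)
Lemma a_form_le0_norm_eq0 (R : realType) (n : nat) (s alpha : R)
    (Omega : set 'rV[R]_n.+1) (u : 'rV[R]_n.+1 -> R) :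
  c_ns (n := n) s <= 0 -> 0 < alpha ->
  ((alpha * Hs_norm s Omega u ^+ 2)%:E <= a_form s Omega u u)%E ->
  Hs_norm s Omega u = 0.
Proof.
move=> c0 alpha0 /le_trans /(_ (a_form_le0 _ _ c0)).
rewrite lee_fin pmulr_rle0 // => N2.
by apply/eqP; rewrite -sqrf_eq0 eq_le N2 sqr_ge0.
Qed.

(** * Multiplier spaces *)

Section multiplier_space.
Context {R : realType} {n : nat}.
Variables (s : R) (Omega : set 'rV[R]_n.+1) (cs : setting R n).
Variable TH : seq 'M[R]_((multiplier_dim cs).+1, n.+1).
Implicit Types mu nu : ('rV[R]_n.+1 -> R) -> R.
Local Notation H := (H_space s Omega cs).

Lemma multiplier_space_dual :
  multiplier_space s Omega TH `<=` dual (Hs_norm s Omega) H.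
Proof. by case: cs TH => [|G|G] T mu []. Qed.

Lemma multiplier_spaceB mu nu :
  multiplier_space s Omega TH mu -> multiplier_space s Omega TH nu ->
  multiplier_space s Omega TH (mu \- nu).
Proof.
have N0 := Hs_norm_ge0 s Omega.
case: cs TH => [|G|G] T [dmu [c muc]] [dnu [d nud]]; split;
    do ?[exact: dual_sub]; exists (fun V => c V - d V).
- by move=> v Hv; rewrite /= muc // nud // -sumrB; apply: eq_bigr => V _; ring.
- by move=> v Hv; rewrite /= muc // nud // -sumrB; apply: eq_bigr => V _; ring.
- move=> v g Hv vg; rewrite /= (muc _ _ Hv vg) (nud _ _ Hv vg) -sumrB.
  by apply: eq_bigr => V _; ring.
Qed.

End multiplier_space.

(** * The error estimates of the mixed method *)

Theorem theorem5p19 (R : realType) (n : nat) (s : R) (Omega : set 'rV[R]_n.+1)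
    (cs : setting R n) :
  0 < s < 1 ->
  polygonal_lipschitz_domain Omega ->
  admissible s Omega cs ->
  let H := H_space s Omega cs in
  let normH := Hs_norm s Omega in
  let normHstar := dual_norm normH H in
  (exists C : R, forall u v, H u -> H v ->
     (a_form s Omega u v <= (C * normH u * normH v)%:E)%E) ->
  (exists2 alpha : R, 0 < alpha & forall u, H u ->
     ((alpha * normH u ^+ 2)%:E <= a_form s Omega u u)%E) ->
  forall sigma beta : R, 0 < beta ->
  exists2 C' : R, 0 < C' &
  forall (Th : seq 'M[R]_(n.+2, n.+1))
         (TH : seq 'M[R]_((multiplier_dim cs).+1, n.+1)),
  triangulation Omega Th -> shape_regular sigma Th ->
  triangulation (multiplier_set Omega cs) TH ->
  let Vh := P1_space Omega H Th in
  let MH := multiplier_space s Omega TH in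
  inf_sup normH H beta MH Vh ->
  forall (L LH : set (('rV[R]_n.+1 -> R) -> R))
         (f : ('rV[R]_n.+1 -> R) -> R) (w : 'rV[R]_n.+1 -> R)
         (u : 'rV[R]_n.+1 -> R) (lam : ('rV[R]_n.+1 -> R) -> R)
         (uh : 'rV[R]_n.+1 -> R) (lamH : ('rV[R]_n.+1 -> R) -> R),
  L `<=` dual normH H -> dual_closed normH H L -> dual_convex L ->
  LH `<=` MH -> dual_closed normH H LH -> dual_convex LH ->
  LH `<=` L ->
  dual normH H f -> H w ->
  H u -> L lam ->
  (forall v, H v -> (a_form s Omega u v + (b_form lam v)%:E = (f v)%:E)%E) ->
  (forall mu, L mu -> b_form (mu \- lam) u <= (mu \- lam) w) ->
  Vh uh -> LH lamH ->
  (forall vh, Vh vh ->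
     (a_form s Omega uh vh + (b_form lamH vh)%:E = (f vh)%:E)%E) ->
  (forall muH, LH muH -> b_form (muH \- lamH) uh <= (muH \- lamH) w) ->
  forall vh muH, Vh vh -> LH muH ->
    normH (u \- uh) ^+ 2 <=
      C' * (normH (u \- vh) ^+ 2 + normHstar (lam \- muH) ^+ 2
            + normHstar (lam \- lamH) ^+ 2) /\
    normHstar (lam \- lamH) <=
      C' * (normH (u \- uh) + normHstar (lam \- muH)).
Proof.
move=> _ [oOmega _ _ _ _] _ H N Nstar [C aC] [alpha alpha0 acoer] sigma beta beta0.
have mOmega := open_measurable_rV oOmega.
pose K1 := 2 * (`|C| ^+ 2 / alpha + 1 / alpha + 1) / alpha.
pose K2 := 1 + 1 / beta + `|C| / beta.
have K1_ge0 : 0 <= K1.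
  have ia := ltW alpha0.
  by rewrite /K1 !(divr_ge0, mulr_ge0, addr_ge0) // sqr_ge0.
have K2_gt0 : 0 < K2.
  have ib := ltW beta0.
  by rewrite /K2 -addrA ltr_wpDr // addr_ge0 ?divr_ge0.
exists (K1 + K2); first by rewrite ltr_wpDl.
move=> Th TH _ _ _ Vh MH ish L LH f w u lam uh lamH LD _ _ LHM _ _ LHL _ _.
move=> Hu Llam u_sol _ Vuh LHlamH uh_sol _ vh muH Vvh LHmuH.
have N_ge0 v : 0 <= N v by exact: Hs_norm_ge0.
have HB u1 u2 : H u1 -> H u2 -> H (u1 \- u2) by exact: H_spaceB.
have VhH : Vh `<=` H by move=> v [].
have Nstar_ge0 mu : 0 <= Nstar mu by exact: dual_norm_ge0.
(* For a nonpositive constant both sides of the estimates vanish. *)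
have [c_le0|c_gt0] := leP (c_ns (n := n) s) 0.
  have N0 v : H v -> N v = 0.
    by move=> Hv; apply: a_form_le0_norm_eq0 c_le0 alpha0 (acoer _ Hv).
  have Nstar0 mu : Nstar mu = 0.
    rewrite /Nstar /dual_norm (_ : [set _ | _ in _] = set0) ?sup0 //.
    by rewrite -subset0 => r [v [Hv]]; rewrite N0 // eqxx.
  rewrite !N0 ?Nstar0 ?expr0n /= ?addr0 ?mulr0 //; apply: HB => //; exact: VhH.
(* The continuity bound on the diagonal makes the form real valued on [H]. *)
have energyH v : H v -> finite_energy s Omega v.
  move=> Hv; split; first exact: H_space_measurable Hv.
  by apply: le_lt_trans (aC _ _ Hv Hv) _; rewrite ltry.
pose A v1 v2 := fine (a_form s Omega v1 v2).
have aE v1 v2 : H v1 -> H v2 -> a_form s Omega v1 v2 = (A v1 v2)%:E.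
  by move=> /energyH e1 /energyH e2; rewrite fineK // a_form_fin_num.
have ABl v1 v2 v : H v1 -> H v2 -> H v -> A (v1 \- v2) v = A v1 v - A v2 v.
  move=> H1 H2 Hv; apply: EFin_inj.
  by rewrite EFinB -!aE //; [apply: a_formBl => //; exact: energyH|exact: HB].
have ABr v v1 v2 : H v -> H v1 -> H v2 -> A v (v1 \- v2) = A v v1 - A v v2.
  by move=> Hv H1 H2; rewrite /A !(a_formC s Omega v); exact: ABl.
have A_le v1 v2 : H v1 -> H v2 -> A v1 v2 <= `|C| * N v1 * N v2.
  move=> H1 H2; have := aC _ _ H1 H2; rewrite aE // lee_fin => /le_trans; apply.
  by rewrite -!mulrA ler_wpM2r ?mulr_ge0 ?ler_norm.
(* The hypothesis bounds the form from above; the lower bound is the upper bound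
   for the opposite first argument, reached by differences alone. *)
have AC v1 v2 : H v1 -> H v2 -> `|A v1 v2| <= `|C| * N v1 * N v2.
  move=> H1 H2; rewrite ler_norml A_le // andbT lerNl.
  have Hz : H (v1 \- v1) by exact: HB.
  have -> : - A v1 v2 = A ((v1 \- v1) \- v1) v2.
    by rewrite !ABl // subrr sub0r.
  apply: le_trans (A_le _ _ (HB _ _ Hz H1) H2) _.
  rewrite /N Hs_normC (_ : v1 \- (v1 \- v1) = v1) //.
  by apply/funext => x; rewrite /= subrr subr0.
have Acoer v : H v -> alpha * N v ^+ 2 <= A v v.
  by move=> Hv; rewrite -lee_fin -aE //; exact: acoer.
have u_solA v : H v -> A u v + lam v = f v.
  by move=> Hv; apply: EFin_inj; rewrite EFinD -aE //; exact: u_sol.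
have uh_solA v : Vh v -> A uh v + lamH v = f v.
  move=> Vv; apply: EFin_inj; rewrite EFinD -aE; last 2 first.
  - exact: VhH.
  - exact: VhH.
  exact: uh_sol.
have dlam := LD _ Llam; have dlamH := LD _ (LHL _ LHlamH).
have dmuH := LD _ (LHL _ LHmuH).
split.
  have E1 := primal_error_estimate N_ge0 HB AC Acoer ABl ABr alpha0 VhH Hu
    Vuh dlam dlamH u_solA uh_solA Vvh.
  apply: le_trans E1 _; rewrite -/K1 -/Nstar -/N.
  apply: ler_pM => //; rewrite ?addr_ge0 ?sqr_ge0 //.
    by rewrite lerDl ltW.
  by rewrite lerD2r lerDl sqr_ge0.
have E2 := multiplier_error_estimate N_ge0 HB AC ABl (normr_ge0 C) beta0 VhH Hu
  Vuh dlam dlamH u_solA uh_solA (multiplier_space_dual (TH := TH)) ish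
  (multiplier_spaceB (LHM _ LHmuH) (LHM _ LHlamH)) dmuH.
apply: le_trans E2 _; rewrite -/K2 -/Nstar -/N.
by rewrite ler_wpM2r ?addr_ge0 // lerDr.
Qed.
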